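(* Let $\tau>0$ and let $(x^k)$, $(h^k)$ in $\mathbb{R}^d$ be generated by the iterative algorithm using the JAGUAR gradient estimator (see context). Put $H_k:=\mathbb{E}[\|h^k-\nabla f(x^k)\|^2]$. Then $$H_{k+1}\le\Big(1-\frac1{2d}\Big)H_k+2d\,\mathbb{E}\big[\|\nabla f(x^{k+1})-\nabla f(x^k)\|^2\big]+\mathbb{E}\big[\|\widetilde\nabla f_\delta(x^k)-\nabla f(x^k)\|^2\big],$$ where $\widetilde\nabla f_\delta(x):=\sum_{i=1}^d\frac{f_\delta(x+\tau e_i)-f_\delta(x-\tau e_i)}{2\tau}e_i$.
   Context: $\|\cdot\|$ is the Euclidean norm on $\mathbb{R}^d$ and $e_1,\dots,e_d$ the standard basis. $f$ is a differentiable objective function, $\delta$ is the oracle noise and $f_\delta(x):=f(x)+\delta(x)$ is the value returned by the zero-order oracle. Iterative algorithm: given $x^0,h^0\in\mathbb{R}^d$, for $k=0,1,2,\dots$: sample $i_k$ uniformly from $\{1,\dots,d\}$, independently; set $h^{k+1}=h^k-\langle h^k,e_{i_k}\rangle e_{i_k}+\frac{f_\delta(x^k+\tau e_{i_k})-f_\delta(x^k-\tau e_{i_k})}{2\tau}e_{i_k}$; set $x^{k+1}=\mathrm{Proc}(x^k,h^{k+1})$, where $\mathrm{Proc}$ is a sequence of actions that produces the next point from the current point using $h^{k+1}$ in place of the true gradient. The expectation is over all randomness.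
   Formalization: The formal theorem assumes d ≥ 2; for d = 1 the claim fails, e.g. f(x)=x²/2, δ(x)=x, Proc(x,h)=x−h, x⁰=h⁰=0 gives H₁=4 while the right-hand side is 3. *)

(* Defs.v *)
From mathcomp Require Import all_boot all_order all_algebra.
From mathcomp Require Import all_classical all_reals all_analysis.

Set Implicit Arguments.
Unset Strict Implicit.
Unset Printing Implicit Defensive.

Import Order.TTheory GRing.Theory Num.Theory.
Import numFieldNormedType.Exports.

Local Open Scope classical_set_scope.
Local Open Scope ring_scope.

(* Built on MathComp-Analysis: R^d is 'rV[R]_d for an arbitrary realType R,
   with coordinates indexed by 'I_d, i.e. from 0. *)

(* 'rV[R]_d equipped with its Borel sigma-algebra. *)
Notation borel_rV R d := (g_sigma_algebraType (@open 'rV[R]_d)).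

Section Euclidean.
Variables (R : realType) (d : nat).
Implicit Types (u v x : 'rV[R]_d) (f : 'rV[R]_d -> R).

Definition basis_vec (i : 'I_d) : 'rV[R]_d := delta_mx 0 i.

Definition dotv u v : R := \sum_(j < d) u 0 j * v 0 j.

(* The library norm `|u| on row vectors is the maximum norm. *)
Definition enorm u : R := Num.sqrt (dotv u u).

Definition grad f x : 'rV[R]_d := \row_(i < d) 'D_(basis_vec i) f x.

Definition central_diff f (tau : R) x (i : 'I_d) : R :=
  (f (x + tau *: basis_vec i) - f (x - tau *: basis_vec i)) / (2 * tau).

Definition fd_grad f (tau : R) x : 'rV[R]_d :=
  \sum_(i < d) central_diff f tau x i *: basis_vec i.

End Euclidean.

Section Sampling.
Context {dT dE : measure_display} {T : measurableType dT}
        {E : measurableType dE} {R : realType} {d : nat}.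
Variable P : probability T R.

Definition uniform_index (X : T -> 'I_d) : Prop :=
  forall i : 'I_d, measurable (X @^-1` [set i]) /\
                   P (X @^-1` [set i]) = (d%:R^-1)%:E.

(* sigma(i_0, zeta_0, ..., i_(k-1), zeta_(k-1)); the index set 'I_d carries
   the discrete sigma-algebra. *)
Definition history (idx : nat -> T -> 'I_d) (zeta : nat -> T -> E) (k : nat) :
    set (set T) :=
  <<s \bigcup_(j in `I_k)
        (preimage_set_system setT (idx j) setT `|`
         preimage_set_system setT (zeta j) measurable) >>.

(* As 'I_d is finite, it suffices to test the events X = i. *)
Definition index_indep (F : set (set T)) (X : T -> 'I_d) : Prop :=
  forall (A : set T) (i : 'I_d), F A ->
    P (A `&` X @^-1` [set i]) = (P A * P (X @^-1` [set i]))%E.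

End Sampling.

(* Main.v *)
(* Writing g = grad f (x^k) and D for the finite-difference gradient at x^k, the
   vector h^(k+1) - g is h^k - g with coordinate i_k replaced by that of D - g.
   As i_k is uniform and independent of the past, which determines x^k and h^k,
     E |h^(k+1) - g|^2 = (1 - 1/d) E |h^k - g|^2 + (1/d) E |D - g|^2.
   Young's inequality |p - q|^2 <= N/(N-1) |p|^2 + N |q|^2 with N = 2d then
   replaces g by grad f (x^(k+1)), and
     (1 - 1/d) * 2d/(2d-1) <= 1 - 1/(2d),   (1/d) * 2d/(2d-1) <= 1   for d > 1.
   All integrands are nonnegative, so no integrability is needed: the integrals
   may be infinite. *)
From HB Require Import structures.
Require Import Defs.
From mathcomp Require Import all_boot all_order all_algebra.
From mathcomp Require Import all_classical all_reals all_analysis.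
From mathcomp Require Import measurable_realfun ring lra.

Import Order.TTheory GRing.Theory Num.Theory.
Import numFieldNormedType.Exports.

Local Open Scope classical_set_scope.
Local Open Scope ring_scope.

(** * Borel measurability on R^d *)

Definition rat_box (R : realType) (d : nat) (p : 'rV[rat]_d * 'rV[rat]_d) :
    set 'rV[R]_d :=
  [set y | forall j, ratr (p.1 0 j) < y 0 j < ratr (p.2 0 j)].

(** Balls of row vectors are cubes, the norm being the maximum norm, so rational endpoints chosen
    separately in each coordinate, within [e] of [y], give a box inside the ball. Only countably
    many such boxes exist, which is what [measurable_fun_rV] needs. *)
Lemma open_bigcup_rat_box (R : realType) (d : nat) (U : set 'rV[R]_d) :
  open U -> U = \bigcup_(p in [set p | rat_box R d p `<=` U]) rat_box R d p.
Proof.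
move=> oU; apply/seteqP; split=> [y Uy|y [p /= pU /pU//]].
have /nbhs_ballP[e /= e0 yeU] : nbhs y U by exact: open_nbhs_nbhs.
have /choice[a aP] j : exists q, y 0 j - e < ratr q < y 0 j.
  have /rat_in_itvoo[q] : y 0 j - e < y 0 j by rewrite ltrBlDr ltrDl.
  by rewrite in_itv; exists q.
have /choice[b bP] j : exists q, y 0 j < ratr q < y 0 j + e.
  have /rat_in_itvoo[q] : y 0 j < y 0 j + e by rewrite ltrDl.
  by rewrite in_itv; exists q.
exists (\row_j a j, \row_j b j) => /= [z zab|j]; last first.
  by rewrite !mxE; have /andP[_ ->] := aP j; have /andP[-> _] := bP j.
apply: yeU; split=> // i j; rewrite ord1 /ball/=.
have := zab j; rewrite !mxE => /andP[az zb].
have /andP[? ?] := aP j; have /andP[? ?] := bP j.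
by rewrite ltr_norml; lra.
Qed.

Lemma measurable_fun_rV d1 (T : measurableType d1) (R : realType) (d : nat)
    (F : T -> borel_rV R d) :
  (forall j, measurable_fun setT (fun w => (F w : 'rV[R]_d) 0 j)) ->
  measurable_fun setT F.
Proof.
move=> mF; apply: (@measurability _ _ _ (borel_rV R d) _ _ (@open 'rV[R]_d) erefl).
move=> _ [U oU <-]; rewrite setTI (open_bigcup_rat_box _ _ _ oU).
(* The boxes outside U are turned into empty sets, so that the union runs over the whole countable
   type of pairs of rational vectors. *)
rewrite preimage_bigcup bigcup_mkcond.
apply: countable_bigcupT_measurable => [|p]; first exact: countableP.
case: ifPn => // _.
rewrite [X in measurable X](_ : _ = \bigcap_(j in [set: 'I_d])
    ((fun w => (F w : 'rV[R]_d) 0 j) @^-1` `]ratr (p.1 0 j), ratr (p.2 0 j)[)).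
  apply: fin_bigcap_measurable => [|j _]; first exact: finite_finset.
  by rewrite -[X in measurable X]setTI; exact: mF.
apply/seteqP; split=> w /= Fw j; first by move=> _ /=; rewrite in_itv; exact: Fw.
by have := Fw j I; rewrite /= in_itv.
Qed.

Lemma continuous_measurable_rV (R : realType) (d : nat) (g : 'rV[R]_d -> R) :
  continuous g -> measurable_fun [set: borel_rV R d] (g : borel_rV R d -> R).
Proof.
move=> /continuousP cg; apply: (measurability _ (RGenOpens.measurableE R)).
move=> _ [_ [a [b ->] <-]]; rewrite setTI.
by apply: sub_sigma_algebra; exact/cg/interval_open.
Qed.

Lemma measurable_coord_rV (R : realType) (d : nat) (j : 'I_d) :
  measurable_fun [set: borel_rV R d]
    (fun x : borel_rV R d => (x : 'rV[R]_d) 0 j).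
Proof. exact: (continuous_measurable_rV _ _ _ (@coord_continuous _ _ _ 0 j)). Qed.

Lemma continuous_measurable_rV_rV (R : realType) (m n : nat) (g : 'rV[R]_m -> 'rV[R]_n) :
  continuous g ->
  measurable_fun [set: borel_rV R m] (g : borel_rV R m -> borel_rV R n).
Proof.
move=> /continuousP cg.
apply: (@measurability _ _ _ (borel_rV R n) _ _ (@open 'rV[R]_n) erefl).
by move=> _ [U oU <-]; rewrite setTI; apply: sub_sigma_algebra; exact: cg.
Qed.

(** A partial derivative need not be continuous, but it is the pointwise limit of the difference
    quotients with step 1/(n+1), which are continuous in x because f is. *)
Lemma measurable_grad_coord (R : realType) (d : nat) (f : 'rV[R]_d -> R) (i : 'I_d) :
  (forall x, differentiable f x) ->
  measurable_fun [set: borel_rV R d] (fun x : borel_rV R d => grad f x 0 i).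
Proof.
move=> df; have cf : continuous f.
  by move=> x; apply: differentiable_continuous.
pose v : 'rV[R]_d := basis_vec R i.
apply: (@measurable_fun_cvg _ _ _ _ (fun n (x : borel_rV R d) =>
  n.+1%:R * (f (n.+1%:R^-1 *: v + (x : 'rV[R]_d)) - f x))).
  move=> n; apply: (measurable_funM (f := cst _)) => //.
  apply: continuous_measurable_rV => x.
  have cfv : {for x, continuous (f \o (fun y : 'rV[R]_d => n.+1%:R^-1 *: v + y))}.
    apply: continuous_comp; last exact: cf.
    apply: continuousD; [exact: cst_continuous|exact: cvg_id].
  exact: (continuousB cfv (cf x)).
move=> x _; rewrite mxE.
have := @diff_derivable _ _ _ f x v (df x) => /cvgr_dnbhsP /(_ (fun n => n.+1%:R^-1)).
(* The factor n+1 is written as the inverse of the step 1/(n+1), to match the quotient in the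
   definition of the derivative. *)
under [in X in _ -> X]eq_fun => n do rewrite -[X in X * _]invrK.
apply; split=> [n|]; first by rewrite invr_eq0 pnatr_eq0.
exact: cvg_harmonic.
Qed.

(* The law of [phi] turns independence on the sigma-algebra generated by [phi]
   into an equality of two measures on R, so no approximation by simple functions
   is needed. *)
Lemma ge0_integral_indep (dT : measure_display) (T : measurableType dT)
    (R : realType) (P : probability T R) (A : set T) (c : {nonneg R}) (phi : T -> R) :
  measurable A -> measurable_fun setT phi -> (forall w, 0 <= phi w) ->
  (forall B : set R, measurable B ->
     P (phi @^-1` B `&` A) = c%:num%:E * P (phi @^-1` B))%E ->
  (\int[P]_(w in A) (phi w)%:E = c%:num%:E * \int[P]_w (phi w)%:E)%E.
Proof.
move=> mA mphi phi0 indep.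
(* The change of variables asks for a nonnegative integrand, and the identity of R is one only on
   this half-line; all values of [phi] lie there. *)
pose D := [set y : R | 0 <= y].
pose Phi : {mfun T >-> R} := HB.pack phi (isMeasurableFun.Build _ _ _ _ _ mphi).
have mEphi A' : measurable_fun A' (fun w => (phi w)%:E).
  by apply/measurable_EFinP; apply: measurable_funTS.
have mEid : measurable_fun D (fun y : R => y%:E).
  by apply/measurable_EFinP; exact: measurable_id.
have mpos : measurable D.
  rewrite [X in measurable X](_ : _ = `[0, +oo[%classic); first exact: measurable_itv.
  by apply/seteqP; split=> y /=; rewrite in_itv/= andbT.
have preT : Phi @^-1` D = setT by apply/seteqP; split=> w _ /=; [|exact: phi0].
have pushE (mu : {measure set T -> \bar R}) :
    (\int[mu]_w (phi w)%:E = \int[pushforward mu Phi]_(y in D) y%:E)%E.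
  rewrite [RHS](ge0_integral_pushforward (phi := Phi)) ?preT// => y.
  by rewrite inE lee_fin.
(* [mrestr P mA] agrees with P inside A and gives mass 0 to the complement, so the integral can be
   extended to the whole space. By [indep], its image under [phi] is c times the image of P. *)
transitivity (\int[mrestr P mA]_(w in A) (phi w)%:E)%E.
  by apply: eq_measure_integral => B mB BA; rewrite /= /mrestr setIidl.
transitivity (\int[mrestr P mA]_w (phi w)%:E)%E.
  rewrite [RHS](@ge0_negligible_integral _ _ _ _ _ (~` A)) ?setDE ?setTI ?setCK//.
  - exact: measurableC.
  - by move=> w _; rewrite lee_fin.
  - by rewrite /= /mrestr setICl measure0.
rewrite -ge0_integral_mscale//; last by move=> w _; rewrite lee_fin.
rewrite !pushE; apply: eq_measure_integral => B mB _.
by rewrite /= /pushforward /mrestr /mscale indep.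
Qed.

(** * Coordinates of the gradient estimators *)

Lemma basis_vecE (R : realType) (d : nat) (i j : 'I_d) :
  basis_vec R i 0 j = (j == i)%:R.
Proof. by rewrite mxE eqxx. Qed.

Lemma dotv_basis (R : realType) (d : nat) (u : 'rV[R]_d) (i : 'I_d) :
  dotv u (basis_vec R i) = u 0 i.
Proof.
rewrite /dotv (bigD1 i)//= basis_vecE eqxx mulr1 big1 ?addr0// => j ji.
by rewrite basis_vecE (negbTE ji) mulr0.
Qed.

Lemma fd_gradE (R : realType) (d : nat) (f : 'rV[R]_d -> R) tau x (i : 'I_d) :
  fd_grad f tau x 0 i = central_diff f tau x i.
Proof.
rewrite /fd_grad summxE (bigD1 i)//= mxE basis_vecE eqxx mulr1 big1 ?addr0// => j ji.
by rewrite mxE basis_vecE eq_sym (negbTE ji) mulr0.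
Qed.

Lemma sqr_enorm (R : realType) (d : nat) (u : 'rV[R]_d) :
  enorm u ^+ 2 = \sum_(j < d) u 0 j ^+ 2.
Proof.
rewrite /enorm /dotv sqr_sqrtr; first by under eq_bigr do rewrite -expr2.
by apply: sumr_ge0 => j _; rewrite -expr2 sqr_ge0.
Qed.

Lemma update_coord (R : realType) (d : nat) (u : 'rV[R]_d) (c : R) (i j : 'I_d) :
  (u - dotv u (basis_vec R i) *: basis_vec R i + c *: basis_vec R i) 0 j =
  if i == j then c else u 0 j.
Proof.
rewrite dotv_basis !mxE eqxx/= eq_sym; case: eqP => [->|_]; last by rewrite !mulr0; ring.
by rewrite !mulr1; ring.
Qed.

(** The noisy objective is only measurable, as the noise is; continuity is used for the translations
    x + c alone. *)
Lemma measurable_central_diff (R : realType) (d : nat) (g : 'rV[R]_d -> R) tau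
    (j : 'I_d) :
  measurable_fun [set: borel_rV R d] (g : borel_rV R d -> R) ->
  measurable_fun [set: borel_rV R d] (fun x : borel_rV R d => central_diff g tau x j).
Proof.
move=> mg; have mshift (c : 'rV[R]_d) :
    measurable_fun [set: borel_rV R d] (fun x : borel_rV R d => g ((x : 'rV[R]_d) + c)).
  apply: (measurableT_comp (f := g : borel_rV R d -> R)
    (g := fun x : borel_rV R d => ((x : 'rV[R]_d) + c) : borel_rV R d)) => //.
  apply: continuous_measurable_rV_rV => x.
  by apply: continuousD; [exact: cvg_id|exact: cst_continuous].
apply: (measurable_funM (g := cst _)) => //.
by apply: measurable_funB; exact: mshift.
Qed.

(** * Adaptedness of the iterates to the history *)

Lemma sub_sigma_measurable_fun (T : pointedType) d2 (U : measurableType d2)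
    (G1 G2 : set (set T)) (F : T -> U) :
  G1 `<=` G2 ->
  measurable_fun [set: g_sigma_algebraType G1] (F : g_sigma_algebraType G1 -> U) ->
  measurable_fun [set: g_sigma_algebraType G2] (F : g_sigma_algebraType G2 -> U).
Proof.
move=> G12 mF _ B mB; have := mF measurableT B mB.
exact: sub_smallest2r.
Qed.

(* [history idx zeta k] is convertible to [<<s history_gen idx zeta k >>]. *)
Definition history_gen {dT dE : measure_display} {T : measurableType dT}
    {E : measurableType dE} {d : nat} (idx : nat -> T -> 'I_d)
    (zeta : nat -> T -> E) (k : nat) : set (set T) :=
  \bigcup_(j in `I_k)
    (preimage_set_system setT (idx j) setT `|`
     preimage_set_system setT (zeta j) measurable).

Notation history_type idx zeta k := (g_sigma_algebraType (history_gen idx zeta k)).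

Section History.
Context {dT dE : measure_display} {T : measurableType dT}
        {E : measurableType dE} {d : nat}.
Variables (idx : nat -> T -> 'I_d) (zeta : nat -> T -> E).

Lemma history_genS k : history_gen idx zeta k `<=` history_gen idx zeta k.+1.
Proof. by apply: bigcup_subset => j /= /ltnW. Qed.

Lemma history_measurable k :
  (forall j i, measurable (idx j @^-1` [set i])) ->
  (forall j, measurable_fun setT (zeta j)) ->
  history idx zeta k `<=` measurable.
Proof.
move=> midx mzeta; apply: smallest_sub; first exact: sigma_algebra_measurable.
apply: bigcup_sub => j _; rewrite subUset; split; last first.
  by move=> _ [B mB <-]; exact: mzeta.
move=> _ [B _ <-]; rewrite setTI.
(* Uniformity gives measurability of the events [idx j = i] only; any other event about the index is
   a finite union of these. *)
rewrite [X in measurable X](_ : _ = \bigcup_(i in B) (idx j @^-1` [set i])).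
  by apply: fin_bigcup_measurable => [|i _]; [exact: finite_finset|exact: midx].
by apply/seteqP; split=> w /=; [exists (idx j w)|case=> i Bi /= ->].
Qed.

(** The history at time k collects the samples j < k, so the k-th sample is visible only from time
    k+1 on. This offset leaves [idx k] free to be independent of the history at time k. *)
Lemma measurable_history_idx k (B : set 'I_d) :
  measurable (idx k @^-1` B : set (history_type idx zeta k.+1)).
Proof.
apply: sub_sigma_algebra; exists k => //=; left.
by exists B => //; rewrite setTI.
Qed.

Lemma measurable_history_zeta k :
  measurable_fun [set: history_type idx zeta k.+1]
    (zeta k : history_type idx zeta k.+1 -> E).
Proof.
move=> _ B mB; apply: sub_sigma_algebra; exists k => //=; right.
by exists B.
Qed.

End History.

(** The iterates at time k are functions of the samples before k, which is what makes independence
    of [idx k] applicable to them. In the induction h comes before x, since x at time k+1 is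
    computed from the new h. *)
Lemma measurable_iterates (R : realType) (d : nat)
  (dT dE : measure_display) (T : measurableType dT) (E : measurableType dE)
  (g : 'rV[R]_d -> R) (tau : R)
  (mg : measurable_fun [set: borel_rV R d] (g : borel_rV R d -> R))
  (Proc : nat -> 'rV[R]_d -> 'rV[R]_d -> E -> 'rV[R]_d)
  (hProc : forall k : nat,
     measurable_fun [set: borel_rV R d * borel_rV R d * E]
       (fun p : borel_rV R d * borel_rV R d * E =>
          (Proc k p.1.1 p.1.2 p.2 : borel_rV R d)))
  (idx : nat -> T -> 'I_d) (zeta : nat -> T -> E)
  (x0 h0 : 'rV[R]_d) (x h : nat -> T -> 'rV[R]_d) :
  (forall w : T, x 0%N w = x0) ->
  (forall w : T, h 0%N w = h0) ->
  (forall (k : nat) (w : T),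
     h k.+1 w = h k w
                - dotv (h k w) (basis_vec R (idx k w)) *: basis_vec R (idx k w)
                + central_diff g tau (x k w) (idx k w)
                    *: basis_vec R (idx k w)) ->
  (forall (k : nat) (w : T),
     x k.+1 w = Proc k (x k w) (h k.+1 w) (zeta k w)) ->
  forall k,
    measurable_fun [set: history_type idx zeta k]
      (x k : history_type idx zeta k -> borel_rV R d) /\
    measurable_fun [set: history_type idx zeta k]
      (h k : history_type idx zeta k -> borel_rV R d).
Proof.
move=> x_0 h_0 hS xS; elim=> [|k [mx mh]].
  have -> : x 0%N = cst x0 by exact/funext.
  have -> : h 0%N = cst h0 by exact/funext.
  by split; exact: measurable_cst.
have sub := @history_genS _ _ _ _ _ idx zeta k.
move: mx mh => /(sub_sigma_measurable_fun _ _ _ _ _ _ sub) mx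
               /(sub_sigma_measurable_fun _ _ _ _ _ _ sub) mh.
have mhS : measurable_fun [set: history_type idx zeta k.+1]
    (h k.+1 : history_type idx zeta k.+1 -> borel_rV R d).
  apply: measurable_fun_rV => j.
  (* On the event [idx k = j] the random index in the central difference may be replaced by the
     fixed j, which leaves a choice between two measurable functions. *)
  rewrite [X in measurable_fun _ X](_ : _ =
      fun w => if idx k w == j then central_diff g tau (x k w) j else h k w 0 j).
    apply: measurable_fun_ifT.
    - apply: (measurable_fun_bool true); rewrite setTI.
      exact: (measurable_history_idx _ _ _ (fun i => (i == j) = true)).
    - exact: (measurableT_comp (measurable_central_diff _ _ _ _ _ mg) mx).
    - exact: (measurableT_comp (measurable_coord_rV _ _ j) mh).
  apply/funext => w; rewrite hS update_coord.
  by case: eqP => // ->.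
split=> //.
rewrite (_ : x k.+1 = (fun w => Proc k (x k w) (h k.+1 w) (zeta k w))); last exact/funext.
apply: (measurableT_comp (hProc k)
   (g := fun w : history_type idx zeta k.+1 =>
           ((x k w : borel_rV R d, h k.+1 w : borel_rV R d), zeta k w))).
apply: measurable_fun_pair; last exact: measurable_history_zeta.
exact: measurable_fun_pair.
Qed.

(** * Young's inequality and the average over the sampled index *)

Lemma sqrB_le_young (R : realFieldType) (N p q : R) : 1 < N ->
  (p - q) ^+ 2 <= N / (N - 1) * p ^+ 2 + N * q ^+ 2.
Proof.
move=> N1; have M0 : 0 < N - 1 by rewrite subr_gt0.
rewrite -subr_ge0.
(* The gap between the two sides is a perfect square over N - 1. *)
rewrite (_ : _ - _ = (p + (N - 1) * q) ^+ 2 / (N - 1)); last by field; rewrite gt_eqF.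
by rewrite divr_ge0 ?sqr_ge0// ltW.
Qed.

Lemma sqr_enormB_le_young (R : realType) (d : nat) (N : R) (u v w : 'rV[R]_d) : 1 < N ->
  enorm (u - v) ^+ 2 <=
  N / (N - 1) * enorm (u - w) ^+ 2 + N * enorm (v - w) ^+ 2.
Proof.
move=> N1; rewrite !sqr_enorm !mulr_sumr -big_split/=.
apply: ler_sum => j _; rewrite !mxE.
rewrite (_ : u 0 j - v 0 j = (u 0 j - w 0 j) - (v 0 j - w 0 j)); last by ring.
exact: sqrB_le_young.
Qed.

(** After exchanging the sums, each fixed j meets exactly one i that selects [b j], and d - 1 others
    that select [a j]. *)
Lemma sum_replace_coord (R : nzRingType) (d : nat) (a b : 'I_d -> R) :
  \sum_(i < d) \sum_(j < d) (if i == j then b j else a j) =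
  (d%:R - 1) * (\sum_(j < d) a j) + \sum_(j < d) b j.
Proof.
rewrite exchange_big/= mulr_sumr -big_split/=; apply: eq_bigr => j _.
rewrite (bigD1 j)//= eqxx addrC; congr (_ + _).
under eq_bigr => i ij do rewrite (negbTE ij).
rewrite sumr_const cardC1 card_ord -[a j *+ _]mulr_natl; congr (_ * _).
(* The cardinality is a truncated predecessor; it equals d - 1 in the ring because the inhabitant j
   of ['I_d] excludes d = 0. *)
by case: d j {a b} => [[]//|d] j; rewrite -natr1 addrK.
Qed.

(** The events X = i partition the space. On each one the integrand is [psi i], which depends on the
    past alone, so independence splits off the factor 1/d. This replaces conditioning on the
    past. *)
Lemma ge0_integral_uniform_index (dT : measure_display) (T : measurableType dT)
    (R : realType) (d : nat) (P : probability T R) (G : set (set T))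
    (X : T -> 'I_d) (psi : 'I_d -> T -> R) :
  <<s G >> `<=` measurable ->
  uniform_index P X -> index_indep P <<s G >> X ->
  (forall i, measurable_fun [set: g_sigma_algebraType G]
               (psi i : g_sigma_algebraType G -> R)) ->
  (forall i w, 0 <= psi i w) ->
  (\int[P]_w (psi (X w) w)%:E = (d%:R^-1)%:E * \int[P]_w (\sum_(i < d) psi i w)%:E)%E.
Proof.
move=> Gm unif indep mpsi psi0.
have mA i : measurable (X @^-1` [set i]) by have [] := unif i.
have mpsiT i : measurable_fun setT (psi i).
  by move=> _ B mB; apply: Gm; exact: mpsi.
have UA : \big[setU/set0]_(i <- enum 'I_d) (X @^-1` [set i]) = setT.
  apply/seteqP; split=> // w _; rewrite -bigcup_seq.
  by exists (X w) => //=; rewrite mem_enum.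
have mpsiX : measurable_fun setT (fun w => psi (X w) w).
  (* A finite sum over the values of X, with indicators, reduces joint measurability to that of each
     [psi i]. *)
  rewrite (_ : (fun w => _) = (fun w => \sum_(i < d) psi i w * \1_(X @^-1` [set i]) w)).
    by apply: measurable_sum => i; apply: measurable_funM => //; exact: measurable_indic.
  apply/funext => w; rewrite (bigD1 (X w))//= indicE mem_set// mulr1 big1 ?addr0//.
  by move=> i iX; rewrite indicE memNset ?mulr0//= => /esym/eqP; apply/negP.
rewrite -[in LHS]UA ge0_integral_bigsetU ?enum_uniq//; last 3 first.
- by apply/trivIsetP => i j _ _ /eqP ij; apply/seteqP; split=> // w /= [-> /ij].
- by rewrite UA; apply/measurable_EFinP.
- by move=> w _; rewrite lee_fin.
under [in RHS]eq_integral do rewrite -sumEFin.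
rewrite ge0_integral_sum//; last 2 first.
- by move=> i; apply/measurable_EFinP.
- by move=> i w _; rewrite lee_fin.
rewrite ge0_sume_distrr; last by move=> i _; apply: integral_ge0 => w _; rewrite lee_fin.
rewrite big_enum/=; apply: eq_bigr => i _.
rewrite (eq_integral (fun w => (psi i w)%:E)); last by move=> w; rewrite inE/= => ->.
have d0 : 0 <= d%:R^-1 :> R by [].
rewrite [LHS](@ge0_integral_indep _ _ _ P _ (NngNum d0))//= => B mB.
have [_ PA] := unif i.
rewrite indep ?PA 1?muleC//.
by rewrite -[X in <<s G >> X]setTI; exact: mpsi.
Qed.

(** * The recursion for the mean squared error *)

Theorem lemma1 (R : realType) (d : nat) (hd : (1 < d)%N)
  (dT dE : measure_display) (T : measurableType dT) (E : measurableType dE)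
  (P : probability T R)
  (f delta : 'rV[R]_d -> R) (tau : R)
  (htau : 0 < tau)
  (hf : forall x : 'rV[R]_d, differentiable f x)
  (hdelta : measurable_fun [set: borel_rV R d] (delta : borel_rV R d -> R))
  (Proc : nat -> 'rV[R]_d -> 'rV[R]_d -> E -> 'rV[R]_d)
  (hProc : forall k : nat,
     measurable_fun [set: borel_rV R d * borel_rV R d * E]
       (fun p : borel_rV R d * borel_rV R d * E =>
          (Proc k p.1.1 p.1.2 p.2 : borel_rV R d)))
  (idx : nat -> T -> 'I_d) (zeta : nat -> T -> E)
  (hzeta : forall k : nat, measurable_fun [set: T] (zeta k))
  (hunif : forall k : nat, uniform_index P (idx k))
  (hindep : forall k : nat, index_indep P (history idx zeta k) (idx k))
  (x0 h0 : 'rV[R]_d) (x h : nat -> T -> 'rV[R]_d) :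
  let fdelta := fun y : 'rV[R]_d => f y + delta y in
  (forall w : T, x 0%N w = x0) ->
  (forall w : T, h 0%N w = h0) ->
  (forall (k : nat) (w : T),
     h k.+1 w = h k w
                - dotv (h k w) (basis_vec R (idx k w)) *: basis_vec R (idx k w)
                + central_diff fdelta tau (x k w) (idx k w)
                    *: basis_vec R (idx k w)) ->
  (forall (k : nat) (w : T),
     x k.+1 w = Proc k (x k w) (h k.+1 w) (zeta k w)) ->
  let H := fun k : nat =>
    'E_P[fun w : T => (enorm (h k w - grad f (x k w)) ^+ 2)%R]%E in
  forall k : nat,
    (H k.+1 <=
       (1 - (2 * d%:R)^-1)%:E * H k
       + (2 * d%:R)%:E
           * 'E_P[fun w : T =>
                    (enorm (grad f (x k.+1 w) - grad f (x k w)) ^+ 2)%R]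
       + 'E_P[fun w : T =>
                (enorm (fd_grad fdelta tau (x k w) - grad f (x k w)) ^+ 2)%R])%E.
Proof.
move=> fdelta x_0 h_0 hS xS H k.
have cf : continuous f by move=> y; exact: differentiable_continuous.
have mfd : measurable_fun [set: borel_rV R d] (fdelta : borel_rV R d -> R).
  by apply: measurable_funD => //; exact: continuous_measurable_rV.
have Hm n : <<s history_gen idx zeta n >> `<=` measurable.
  by apply: history_measurable => // j i; have [] := hunif j i.
have mit := measurable_iterates _ _ _ _ _ _ _ tau mfd _ hProc _ _ _ _ _ _ x_0 h_0 hS xS.
have mgrad n j : measurable_fun [set: history_type idx zeta n]
    (fun w : history_type idx zeta n => grad f (x n w) 0 j).
  have [mx _] := mit n.
  exact: (measurableT_comp (measurable_grad_coord _ _ _ j hf) mx).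
have mcoord n j : measurable_fun [set: history_type idx zeta n]
    (fun w : history_type idx zeta n => h n w 0 j).
  have [_ mh] := mit n.
  exact: (measurableT_comp (measurable_coord_rV _ _ j) mh).
have mcd n j : measurable_fun [set: history_type idx zeta n]
    (fun w : history_type idx zeta n => central_diff fdelta tau (x n w) j).
  have [mx _] := mit n.
  exact: (measurableT_comp (measurable_central_diff _ _ _ _ j mfd) mx).
(* Integrals against P are taken on the full sigma-algebra, whereas the independence argument needs
   measurability for the history; this passes from the second to the first. *)
have toT n (F : T -> R) : measurable_fun [set: history_type idx zeta n]
    (F : history_type idx zeta n -> R) -> measurable_fun setT F.
  by move=> mF _ B mB; apply: Hm; exact: mF.
pose a j w := (h k w 0 j - grad f (x k w) 0 j) ^+ 2.
pose b j w := (central_diff fdelta tau (x k w) j - grad f (x k w) 0 j) ^+ 2.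
have ma j : measurable_fun [set: history_type idx zeta k]
    (a j : history_type idx zeta k -> R).
  by apply: measurable_funX; exact: measurable_funB.
have mb j : measurable_fun [set: history_type idx zeta k]
    (b j : history_type idx zeta k -> R).
  by apply: measurable_funX; exact: measurable_funB.
have a0 j w : 0 <= a j w by exact: sqr_ge0.
have b0 j w : 0 <= b j w by exact: sqr_ge0.
(* The sampled index is kept as a parameter: for fixed i this is determined by the history at time
   k, and i = [idx k w] gives the squared distance from the new h to the old gradient
   ([psi_enorm]). *)
pose psi i w := \sum_(j < d) (if i == j then b j w else a j w).
pose SA w := \sum_(j < d) a j w.
pose SB w := \sum_(j < d) b j w.
pose SG w := enorm (grad f (x k.+1 w) - grad f (x k w)) ^+ 2.
have HkE : (H k = \int[P]_w (SA w)%:E)%E.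
  rewrite /H unlock; apply: eq_integral => w _; rewrite sqr_enorm.
  by congr EFin; apply: eq_bigr => j _; rewrite /a !mxE.
have EBE : ('E_P[fun w => (enorm (fd_grad fdelta tau (x k w) - grad f (x k w)) ^+ 2)%R]
            = \int[P]_w (SB w)%:E)%E.
  rewrite unlock; apply: eq_integral => w _; rewrite sqr_enorm.
  by congr EFin; apply: eq_bigr => j _; rewrite /b !mxE -fd_gradE.
have psi_enorm w : psi (idx k w) w = enorm (h k.+1 w - grad f (x k w)) ^+ 2.
  rewrite sqr_enorm; apply: eq_bigr => j _.
  by rewrite /a /b !mxE hS update_coord; case: eqP => [<-|].
have mpsi i : measurable_fun [set: history_type idx zeta k]
    (psi i : history_type idx zeta k -> R).
  by apply: measurable_sum => j; case: (i == j).
have psi0 i w : 0 <= psi i w by apply: sumr_ge0 => j _; case: ifP.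
have mSA : measurable_fun setT SA by apply: measurable_sum => j; exact: (toT k).
have mSB : measurable_fun setT SB by apply: measurable_sum => j; exact: (toT k).
have SA0 w : 0 <= SA w by exact: sumr_ge0.
have SB0 w : 0 <= SB w by exact: sumr_ge0.
have SG0 w : 0 <= SG w by exact: sqr_ge0.
have mSG : measurable_fun setT SG.
  rewrite (_ : SG = fun w =>
      \sum_(j < d) (grad f (x k.+1 w) 0 j - grad f (x k w) 0 j) ^+ 2).
    apply: measurable_sum => j; apply: measurable_funX; apply: measurable_funB.
      exact: (toT k.+1).
    exact: (toT k).
  by apply/funext => w; rewrite /SG sqr_enorm; apply: eq_bigr => j _; rewrite !mxE.
have mSH : measurable_fun setT (fun w => enorm (h k.+1 w - grad f (x k.+1 w)) ^+ 2).
  rewrite (_ : (fun w => _) = fun w =>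
      \sum_(j < d) (h k.+1 w 0 j - grad f (x k.+1 w) 0 j) ^+ 2).
    apply: measurable_sum => j; apply: (toT k.+1); apply: measurable_funX.
    exact: measurable_funB.
  by apply/funext => w; rewrite sqr_enorm; apply: eq_bigr => j _; rewrite !mxE.
have mS' : measurable_fun setT (fun w => psi (idx k w) w).
  under eq_fun do rewrite psi_enorm.
  rewrite (_ : (fun w => _) = fun w =>
      \sum_(j < d) (h k.+1 w 0 j - grad f (x k w) 0 j) ^+ 2).
    apply: measurable_sum => j; apply: measurable_funX; apply: measurable_funB.
      exact: (toT k.+1).
    exact: (toT k).
  by apply/funext => w; rewrite sqr_enorm; apply: eq_bigr => j _; rewrite !mxE.
pose N : R := 2 * d%:R.
have d2 : 2 <= d%:R :> R by rewrite ler_nat.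
have dm1 : 0 <= d%:R - 1 :> R by lra.
have N1 : 1 < N by rewrite /N; lra.
pose c := N / (N - 1).
have c0 : 0 <= c by rewrite divr_ge0 /c /N; lra.
(* Averaging over the index: each coordinate is refreshed with probability 1/d and kept with
   probability (d-1)/d. *)
have intS' : (\int[P]_w (psi (idx k w) w)%:E =
    (d%:R^-1)%:E * ((d%:R - 1)%:E * \int[P]_w (SA w)%:E + \int[P]_w (SB w)%:E))%E.
  rewrite (ge0_integral_uniform_index _ _ _ _ _ _ _ _ (Hm k) (hunif k)
    (hindep k) mpsi psi0).
  congr *%E.
  rewrite (eq_integral (fun w => (d%:R - 1)%:E * (SA w)%:E + (SB w)%:E)%E); last first.
    by move=> w _; rewrite /psi sum_replace_coord EFinD EFinM.
  rewrite ge0_integralD//; last 4 first.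
  - by move=> w _; rewrite -EFinM lee_fin mulr_ge0.
  - by apply/measurable_EFinP; apply: measurable_funM.
  - by move=> w _; rewrite lee_fin.
  - by apply/measurable_EFinP.
  rewrite ge0_integralZl_EFin//; first by move=> w _; rewrite lee_fin.
  exact/measurable_EFinP.
rewrite HkE EBE /H.
have expectE (F : T -> R) : ('E_P[F] = \int[P]_w (F w)%:E)%E by rewrite unlock.
rewrite !expectE.
have mE (F : T -> R) : measurable_fun setT F -> measurable_fun setT (fun w => (F w)%:E).
  by move=> mF; exact/measurable_EFinP.
have mcS : measurable_fun setT (fun w => c * psi (idx k w) w).
  exact: (measurable_funM (measurable_cst c) mS').
have mNG : measurable_fun setT (fun w => N * SG w).
  exact: (measurable_funM (measurable_cst N) mSG).
have N0 : 0 <= N by lra.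
(* Pointwise Young inequality through the intermediate point [grad f (x k w)], then monotonicity of
   the integral. *)
have young : (\int[P]_w (enorm (h k.+1 w - grad f (x k.+1 w)) ^+ 2)%:E <=
     \int[P]_w (c * psi (idx k w) w + N * SG w)%:E)%E.
  apply: ge0_le_integral.
  - exact: measurableT.
  - by move=> w _; rewrite lee_fin sqr_ge0.
  - exact: mE.
  - exact: (mE _ (measurable_funD mcS mNG)).
  - move=> w _; rewrite lee_fin psi_enorm.
    exact: sqr_enormB_le_young.
apply: (le_trans young).
rewrite (eq_integral (fun w => (c * psi (idx k w) w)%:E + (N * SG w)%:E)%E); last first.
  by move=> w _; rewrite EFinD.
rewrite ge0_integralD; last 5 first.
- exact: measurableT.
- by move=> w _; rewrite lee_fin mulr_ge0.
- exact: mE.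
- by move=> w _; rewrite lee_fin mulr_ge0.
- exact: mE.
have pull (r : R) (F : T -> R) :
    0 <= r -> measurable_fun setT F -> (forall w, 0 <= F w) ->
    (\int[P]_w (r * F w)%:E = r%:E * \int[P]_w (F w)%:E)%E.
  move=> r0 mF F0; under eq_integral do rewrite EFinM.
  apply: ge0_integralZl_EFin => //; last exact: mE.
  by move=> w _; rewrite lee_fin.
rewrite (pull _ (fun w => psi (idx k w) w))// pull//.
have IA0 : (0 <= \int[P]_w (SA w)%:E)%E by apply: integral_ge0 => w _; rewrite lee_fin.
have IB0 : (0 <= \int[P]_w (SB w)%:E)%E by apply: integral_ge0 => w _; rewrite lee_fin.
(* The gradient-drift term is the same on both sides and is cancelled. *)
rewrite addeAC leeD2r// intS'.
(* Distributivity in the extended reals is justified by nonnegativity of both integrals, which may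
   be infinite. *)
rewrite muleA -EFinM ge0_muleDr ?mule_ge0// muleA -EFinM.
have cd : c / d%:R = 2 / (N - 1).
  by rewrite /c /N; field; rewrite !gt_eqF//; lra.
apply: leeD.
  apply: lee_wpmul2r => //; rewrite lee_fin cd -/N.
  rewrite -subr_ge0.
  (* With N = 2d the coefficient is 2(d-1)/(N-1) = (N-2)/(N-1), and 1 - 1/N exceeds it by 1/(N-1) -
     1/N. *)
  rewrite (_ : _ - _ = (N * (N - 1))^-1).
    by rewrite invr_ge0 mulr_ge0//; lra.
  by rewrite /N; field; rewrite !gt_eqF//; lra.
(* The coefficient 2/(N-1) is at most 1 because d >= 2 gives N - 1 >= 3. *)
rewrite -[leRHS]mul1e lee_wpmul2r// lee_fin cd ler_pdivrMr ?mul1r /N; lra.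
Qed.
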